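(* Let $Y$ be a finite graph with an edge-free action of a finite group $G$, let $\mathbb{X}=Y/\!\!/G=(X,X_v)$ be the quotient graph of groups, and let $\rho$ be a representation of $G$ of degree $d$. Let $k=\#H(X)$, write $c_\rho(v)=\sum_{g\in X_v}\rho(g)$ for $v\in V(X)$, and let $W_\rho$ be the $kd\times kd$ block matrix whose $d\times d$ block at $(h,h')\in H(X)\times H(X)$ is $$(W_\rho)_{hh'}=\begin{cases}(c_\rho(r(h'))-I_d)\,\rho(F(h')), & h'=\overline h,\\ c_\rho(r(h'))\,\rho(F(h')), & h'\neq\overline h\text{ and }r(\overline h)=r(h'),\\ 0, & r(\overline h)\ne r(h').\end{cases}$$ Then the $L$-function of $Y/\mathbb{X}$ evaluated at $\rho$ satisfies $$L(u,\rho,Y/\mathbb{X})^{-1}=\det(I_{kd}-W_\rho u).$$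
   Context: Graphs. A graph (with legs) $X$ consists of vertices $V(X)$, half-edges $H(X)$, a root map $r:H(X)\to V(X)$, and an involution $h\mapsto\overline h$ on $H(X)$. Orbits $\{h,\overline h\}$ of size 2 are edges; half-edges with $\overline h=h$ are legs, forming the set $L(X)$. All graphs are connected. A path of length $n\ge1$ in $X$ is a sequence $h_1\cdots h_n$ of half-edges with $r(h_{j+1})=r(\overline{h_j})$ for $1\le j\le n-1$; it is closed if $r(\overline{h_n})=r(h_1)$. Graphs of groups. An edge-trivial graph of groups $\mathbb{X}=(X,X_v)$ is a graph $X$ with a group $X_v$ for each $v\in V(X)$. A path of length $n\ge1$ in $\mathbb{X}$ is $g_0h_1g_1h_2\cdots g_{n-1}h_n$ where $h_1\cdots h_n$ is a path in $X$, $g_0\in X_{r(h_1)}$ and $g_j\in X_{r(\overline{h_j})}$ for $1\le j\le n-1$. It is closed if $h_1\cdots h_n$ is closed; a closed path is reduced if for each $j\in\{1,\dots,n\}$ (indices mod $n$) either $h_{j+1}\ne\overline{h_j}$ or $g_j\ne1$. A closed reduced path is primitive if it is not a power $R^k$, $k\ge2$, of a path. Closed paths of the same length are equivalent if they differ by a simultaneous cyclic shift of the $g_{j-1}$ and $h_j$. A prime of $\mathbb{X}$ is an equivalence class of primitive paths. $\ell(Q)$ denotes the length of a path $Q$. Quotients. A $G$-action on $Y$ (by bijections of $V(Y)$ and $H(Y)$ commuting with $r$ and the involution) is edge-free if $G$ acts freely on $H(Y)$. The quotient graph $X=Y/G$ has $V(X)=V(Y)/G$, $H(X)=H(Y)/G$,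 with induced root map and involution; $\pi:Y\to X$ is the projection. Choose a spanning tree $T_X\subset X$ and a connected lift $T\subset Y$ of it; for $v\in V(X)$ let $v^T$ be its lift to $T$. The graph of groups $\mathbb{X}=Y/\!\!/G$ has underlying graph $X$ and $X_v=$ stabilizer of $v^T$ in $G$. For each $h\in H(X)$ choose $h^S\in H(Y)$ above $h$ and $F(h)\in G$ as follows. If $h\in H(T_X)$, $h^S$ is its lift to $T$ and $F(h)=1$. For each edge of $X$ not in $T_X$ choose an orientation $(h,\overline h)$ and let $v=r(\overline h)$; choose $h^S$ above $h$ rooted at $r(h)^T$, choose $F(h)\in G$ with $F(h)(v^T)=r(\overline{h^S})$, and set $F(\overline h)=F(h)^{-1}$, $(\overline h)^S=F(\overline h)(\overline{h^S})$. For a leg $l$ of $X$ whose preimages are legs of $Y$, choose a leg $l^S$ above $l$ rooted at $r(l)^T$ and set $F(l)=1$. For a leg $l$ of $X$ whose preimages belong to edges of $Y$, choose an edge $\{h,\overline h\}$ of $Y$ with $\pi(h)=l$, $r(h)=r(l)^T$, set $l^S=h$, and let $F(l)$ be the unique (order 2) element of $G$ sending $h$ to $\overline h$. All these choices are fixed. The Frobenius element of a path $Q=g_0h_1g_1\cdots g_{n-1}h_n$ in $\mathbb{X}$ is $F(Q)=g_0F(h_1)g_1F(h_2)\cdots g_{n-1}F(h_n)\in G$. Representations are finite-dimensional and complex. The Artin–Ihara $L$-function is $$L(u,\rho,Y/\mathbb{X})=\prod_{\mathfrak q}\det\bigl(I_d-\rho(F(Q))u^{\ell(Q)}\bigr)^{-1},$$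 the product over all primes $\mathfrak q$ of $\mathbb{X}$, where $Q$ is an arbitrary representative of $\mathfrak q$ (different representatives have conjugate Frobenius elements); it converges for sufficiently small complex $u$. *)

(* Defs.v *)
From HB Require Import structures.
From mathcomp Require Import all_boot all_order all_algebra all_fingroup.
From mathcomp Require Import mxrepresentation finmap.
From mathcomp Require Import all_classical reals topology normedtype complex.
From mathcomp.analysis Require Import showcase.summability.

Set Implicit Arguments.
Unset Strict Implicit.
Unset Printing Implicit Defensive.

Import Order.TTheory GRing.Theory Num.Theory numFieldNormedType.Exports.

Local Open Scope quotient_scope.
Local Open Scope ring_scope.

Record graph := Graph {
  vert : finType;
  hedge : finType;
  root : hedge -> vert;
  bar : hedge -> hedge;
  barK : involutive bar }.

Definition linked (X : graph) (h h' : hedge X) := root h' == root (bar h).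

Definition is_leg (X : graph) (h : hedge X) := bar h == h.

Definition adjacent_in (X : graph) (S : {set hedge X}) : rel (vert X) :=
  fun v w => [exists h in S, (root h == v) && (root (bar h) == w)].

Definition graph_connected (X : graph) : Prop :=
  forall v w : vert X, connect (adjacent_in [set: hedge X]) v w.

(* A spanning tree contains every vertex, so it is given by its half-edges.   *)
Record spanning_tree (X : graph) (S : {set hedge X}) : Prop := {
  tree_bar : forall h, h \in S -> bar h \in S;
  tree_nolegs : forall h, h \in S -> ~~ is_leg h;
  tree_connected : forall v w : vert X, connect (adjacent_in S) v w;
  tree_acyclic : forall p : seq (hedge X), p != [::] ->
    all (mem S) p -> path.cycle (@linked X) p ->
    ~~ path.cycle (fun h h' => h' != bar h) p }.

(* Left actions, g . (k . x) = (g k) . x; MathComp's [action] is a right      *)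
(* action, and the order of multiplication matters for Frobenius elements.    *)
Record graph_action (gT : finGroupType) (Y : graph) := GraphAction {
  actv : gT -> vert Y -> vert Y;
  acth : gT -> hedge Y -> hedge Y;
  actv1 : forall v, actv 1%g v = v;
  actvM : forall g k v, actv (g * k)%g v = actv g (actv k v);
  acth1 : forall h, acth 1%g h = h;
  acthM : forall g k h, acth (g * k)%g h = acth g (acth k h);
  act_root : forall g h, root (acth g h) = actv g (root h);
  act_bar : forall g h, bar (acth g h) = acth g (bar h) }.

Definition edge_free (gT : finGroupType) (Y : graph) (a : graph_action gT Y) :=
  forall g h, acth a g h = h -> g = 1%g.

Section OrbitRelation.
Variables (gT : finGroupType) (T : finType) (act : gT -> T -> T).
Hypothesis act1 : forall x, act 1%g x = x.
Hypothesis actM : forall g k x, act (g * k)%g x = act g (act k x).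

Definition same_orbit : rel T := fun x y => [exists g, act g x == y].

Lemma same_orbit_equiv : equiv_class_of same_orbit.
Proof.
split.
- by move=> x; apply/existsP; exists 1%g; rewrite act1.
- have sym x y : same_orbit x y -> same_orbit y x.
    case/existsP=> g /eqP <-; apply/existsP; exists g^-1%g.
    by rewrite -actM mulVg act1.
  by move=> x y; apply/idP/idP; apply: sym.
- move=> y x z /existsP[g /eqP <-] /existsP[k /eqP <-].
  by apply/existsP; exists (k * g)%g; rewrite actM.
Qed.

End OrbitRelation.

Section Quotient.
Variables (gT : finGroupType) (Y : graph) (a : graph_action gT Y).

Definition orbv := EquivRelPack (same_orbit_equiv (actv1 a) (actvM a)).
Definition orbh := EquivRelPack (same_orbit_equiv (acth1 a) (acthM a)).

Definition qvert := {eq_quot orbv}.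
HB.instance Definition _ := EqQuotient.on qvert.
HB.instance Definition _ := Choice.on qvert.
HB.instance Definition _ := Countable.copy qvert (can_type (@reprK _ qvert)).
HB.instance Definition _ : isFinite qvert := CanIsFinite (@reprK _ qvert).

Definition qhedge := {eq_quot orbh}.
HB.instance Definition _ := EqQuotient.on qhedge.
HB.instance Definition _ := Choice.on qhedge.
HB.instance Definition _ :=
  Countable.copy qhedge (can_type (@reprK _ qhedge)).
HB.instance Definition _ : isFinite qhedge := CanIsFinite (@reprK _ qhedge).

Definition piv (v : vert Y) : qvert := \pi v.
Definition pih (h : hedge Y) : qhedge := \pi h.

Definition qroot (x : qhedge) : qvert := piv (root (generic_quotient.repr x)).
Definition qbar (x : qhedge) : qhedge := pih (bar (generic_quotient.repr x)).

Lemma piv_act g v : piv (actv a g v) = piv v.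
Proof.
by apply/esym/eqmodP; apply/existsP; exists g.
Qed.

Lemma pih_act g h : pih (acth a g h) = pih h.
Proof.
by apply/esym/eqmodP; apply/existsP; exists g.
Qed.

Lemma pih_repr h : exists g, acth a g h = generic_quotient.repr (pih h).
Proof.
have /eqmodP/existsP[g /eqP <-] : h = generic_quotient.repr (pih h) %[mod {eq_quot orbh}].
  by rewrite reprK.
by exists g.
Qed.

Lemma qroot_pi h : qroot (pih h) = piv (root h).
Proof. by rewrite /qroot; have [g <-] := pih_repr h; rewrite act_root piv_act. Qed.

Lemma qbar_pi h : qbar (pih h) = pih (bar h).
Proof. by rewrite /qbar; have [g <-] := pih_repr h; rewrite act_bar pih_act. Qed.

Lemma qbarK : involutive qbar.
Proof. by move=> x; rewrite [qbar x]/qbar qbar_pi barK /pih reprK. Qed.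

Definition quotient_graph : graph := Graph qroot qbarK.

Lemma stab_group_set v : group_set [set g | actv a g v == v].
Proof.
apply/group_setP; split; first by rewrite inE actv1.
by move=> g k; rewrite !inE actvM => /eqP ? /eqP ->; apply/eqP.
Qed.

Definition stab v : {group gT} := group (stab_group_set v).

(* The spanning tree T_X, the lift T of T_X to Y, the half-edges h^S and the  *)
(* elements F(h). The connected lift T is the image of [vlift] and of the     *)
(* restriction of [hlift] to T_X, which together form a section of the        *)
(* projection over T_X that commutes with root maps and involutions.          *)
Record quotient_choice := QuotientChoice {
  tree : {set hedge quotient_graph};
  treeP : spanning_tree tree;
  vlift : vert quotient_graph -> vert Y;
  vliftP : forall v, piv (vlift v) = v;
  hlift : hedge quotient_graph -> hedge Y;
  hliftP : forall h, pih (hlift h) = h;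
  frob : hedge quotient_graph -> gT;
  hlift_tree : forall h, h \in tree ->
    root (hlift h) = vlift (root h) /\ bar (hlift h) = hlift (bar h);
  frob_tree : forall h, h \in tree -> frob h = 1%g;
  orient : {set hedge quotient_graph};
  orientP : forall h, h \notin tree -> ~~ is_leg h ->
    (bar h \in orient) = (h \notin orient);
  hlift_orient : forall h, h \notin tree -> ~~ is_leg h -> h \in orient ->
    root (hlift h) = vlift (root h);
  frob_orient : forall h, h \notin tree -> ~~ is_leg h -> h \in orient ->
    actv a (frob h) (vlift (root (bar h))) = root (bar (hlift h));
  frob_bar : forall h, h \notin tree -> ~~ is_leg h -> h \in orient ->
    frob (bar h) = (frob h)^-1%g;
  hlift_bar : forall h, h \notin tree -> ~~ is_leg h -> h \in orient ->
    hlift (bar h) = acth a (frob (bar h)) (bar (hlift h));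
  hlift_leg : forall l : hedge quotient_graph, is_leg l -> root (hlift l) = vlift (root l);
  frob_leg_leg : forall l : hedge quotient_graph, is_leg l ->
    (forall h, pih h = l -> is_leg h) -> frob l = 1%g;
  frob_leg_edge : forall l : hedge quotient_graph, is_leg l ->
    (forall h, pih h = l -> ~~ is_leg h) ->
    acth a (frob l) (hlift l) = bar (hlift l) }.

End Quotient.

(* The vertex groups are subgroups of one finite group, as they are for a     *)
(* quotient Y//G.                                                             *)
Record graph_of_groups (gT : finGroupType) := GraphOfGroups {
  base :> graph;
  vgroup : vert base -> {group gT} }.

Definition quotient_gog (gT : finGroupType) (Y : graph) (a : graph_action gT Y)
    (c : quotient_choice a) : graph_of_groups gT :=
  GraphOfGroups (fun v : vert (quotient_graph a) => stab a (vlift c v)).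

Section Paths.
Variables (gT : finGroupType) (X : graph_of_groups gT).

(* g_0 h_1 g_1 h_2 ... g_(n-1) h_n is the sequence of the (g_(j-1), h_j).     *)
Definition word := seq (gT * hedge X).

Definition gog_path (Q : word) : bool :=
  [&& Q != [::], all (fun s => s.1 \in vgroup (root s.2)) Q
    & sorted (fun s t => linked s.2 t.2) Q].

Definition closed_path (Q : word) : bool :=
  gog_path Q && path.cycle (fun s t => linked s.2 t.2) Q.

Definition reduced (Q : word) : bool :=
  path.cycle (fun s t => (t.2 != bar s.2) || (t.1 != 1%g)) Q.

Definition power (R : word) (k : nat) : word := flatten (nseq k R).

Definition primitive (Q : word) : Prop :=
  [/\ closed_path Q, reduced Q
    & forall R k, (2 <= k)%N -> gog_path R -> Q <> power R k].

Definition primitive_word := {Q : word | `[< primitive Q >]}.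

Definition cyclic_shift : rel primitive_word :=
  fun Q Q' => `[< exists n, val Q' = rot n (val Q) >].

Lemma cyclic_shift_equiv : equiv_class_of cyclic_shift.
Proof.
split.
- by move=> Q; apply/asboolP; exists 0%N; rewrite rot0.
- have sym Q Q' : cyclic_shift Q Q' -> cyclic_shift Q' Q.
    move=> /asboolP[n eQ']; apply/asboolP.
    by exists (size (rot n (val Q)) - n)%N; rewrite eQ' -[RHS]/(rotr n _) rotK.
  by move=> Q Q'; apply/idP/idP; apply: sym.
- move=> Q2 Q1 Q3 /asboolP[m e2] /asboolP[n e3]; apply/asboolP.
  rewrite e3 e2.
  have [mQ|mQ] := leqP m (size (val Q1)).
    have [nQ|nQ] := leqP n (size (val Q1)).
      by rewrite rot_add_mod //; eexists.
    by exists m; rewrite [LHS]rot_oversize // size_rot ltnW.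
  by exists n; rewrite [X in rot n X]rot_oversize // ltnW.
Qed.

Definition shift_equiv := EquivRelPack cyclic_shift_equiv.

Definition prime_path := {eq_quot shift_equiv}.
HB.instance Definition _ := Choice.on prime_path.

Definition prime_rep (q : prime_path) : word := val (generic_quotient.repr q).

Variable F : hedge X -> gT.

Definition frobenius (Q : word) : gT := (\prod_(s <- Q) (s.1 * F s.2))%g.

Lemma frobenius_rot n Q : exists x, frobenius (rot n Q) = (frobenius Q ^ x)%g.
Proof.
exists (frobenius (take n Q)); rewrite -{2}(cat_take_drop n Q) /rot.
by rewrite /frobenius !big_cat /= conjgE !mulgA mulVg mul1g.
Qed.

Variables (C : numFieldType) (d : nat) (rho : mx_representation C [set: gT] d).

Definition euler_factor (u : C) (q : prime_path) : C :=
  \det (1%:M - u ^+ size (prime_rep q) *: rho (frobenius (prime_rep q))).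

Definition partial_euler_product (u : C) (A : {fset prime_path}) : C :=
  \prod_(q <- A) (euler_factor u q)^-1.

(* Unordered convergence over the primes, along the finite sets of primes.    *)
Definition Lfun_converges (u : C) : Prop :=
  (forall q, euler_factor u q != 0) /\
  cvg (partial_euler_product u @ totally)%classic.

Definition Lfun (u : C) : C := lim (partial_euler_product u @ totally)%classic.

Definition c_rho (v : vert X) : 'M[C]_d := \sum_(g in vgroup v) rho g.

Definition W_block (h h' : hedge X) : 'M[C]_d :=
  if h' == bar h then (c_rho (root h') - 1%:M) *m rho (F h')
  else if root (bar h) == root h' then c_rho (root h') *m rho (F h')
  else 0.

Definition W_rho : 'M[C]_(\sum_(i < #|hedge X|) d) :=
  \mxblock_(i < #|hedge X|, j < #|hedge X|)
    W_block (enum_val i) (enum_val j).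

End Paths.

(* Main.v *)
Require Import Defs.
From mathcomp Require Import all_boot all_order all_algebra all_fingroup.
From mathcomp Require Import mxrepresentation all_classical reals topology normedtype complex.
From mathcomp Require Import spectral finmap ring zify.
From mathcomp.analysis Require Import showcase.summability.
Import Order.TTheory GRing.Theory Num.Theory numFieldNormedType.Exports.

(* The trace of W_rho^n is the sum of tr rho(F(w)) over the closed reduced     *)
(* paths w of length n. Each w is a rotation of R^(n / l(R)) for a             *)
(* representative R of a unique prime, and the l(R) rotations are distinct, so *)
(* the trace is the sum of l(R) tr rho(F(R))^(n / l(R)) over the primes whose  *)
(* length divides n. These are the coefficients of the logarithmic derivatives *)
(* of both sides: the product of the Euler factors over any finite set of      *)
(* primes containing those of length at most N agrees with det(I - W_rho u)    *)
(* modulo u^(N+1). Factoring all determinants over eigenvalues bounds the      *)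
(* weighted l^1 norms of these polynomials uniformly on a disc, and hence the  *)
(* remaining terms on a smaller one.                                           *)

Set Implicit Arguments.
Unset Strict Implicit.
Unset Printing Implicit Defensive.

Local Open Scope ring_scope.

(** * Eigenvalues *)

(** The proof has a combinatorial, an algebraic and an analytic layer.

    Combinatorics: a block of $W_\rho$ is a sum over the letters $(g,h')$ allowed after a half-edge
    ([W_blockE]), so $\mathrm{tr}\,W_\rho^n$ is a sum over closed reduced paths ([trace_W_rhoX]).
    Each such path is a rotation of a power of a representative of a unique prime
    ([perm_cyclic_words]). The trace does not see the rotation, which gives [trace_W_rhoX_primes].

    Algebra: in terms of eigenvalues, the determinants on both sides become products of factors
    $1-zu^\ell$. The trace formula says that their power sums agree, and the recursion behind
    Newton's identities turns this into equality of low coefficients ([eulerprod_coef_eq]).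

    Analysis: agreement of coefficients does not yet give convergence. Since there are at most
    exponentially many primes of each length ([sum_prime_le]), some radius $r$ gives
    $\sum_i|a_i|r^i\le 2$ for all the polynomials involved ([wsize_radius]). For $|u|\le r/2$ the
    terms beyond degree $N$ are then $O(2^{-N})$ ([eulerprod_close]), and [Lfun_det] passes to the
    limit and inverts. *)

Lemma trig_mxX (K : comNzRingType) n (T : 'M[K]_n) k : is_trig_mx T ->
  is_trig_mx (T ^+ k) /\ forall i, (T ^+ k) i i = T i i ^+ k.
Proof.
move=> /is_trig_mxP Ttrig; elim: k => [|k [/is_trig_mxP IHt IHd]].
  split; last by move=> i; rewrite !expr0 mxE eqxx.
  by apply/is_trig_mxP => i j lt_ij; rewrite expr0 mxE -val_eqE /= ltn_eqF.
rewrite exprS; split.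
  apply/is_trig_mxP => i j lt_ij; rewrite mxE big1 // => l _.
  have [lt_il|le_li] := ltnP i l; first by rewrite Ttrig ?mul0r.
  by rewrite IHt ?mulr0 // (leq_ltn_trans le_li).
move=> i; rewrite mxE (bigD1 i) //= IHd -exprS big1 ?addr0 // => l ne_li.
have [lt_il|le_li] := ltnP i l; first by rewrite Ttrig ?mul0r.
by rewrite IHt ?mulr0 // ltn_neqAle le_li andbT ne_li.
Qed.

(** Schur triangularization: the diagonal of a triangular form carries both the determinant and the
    traces of powers. The list is given in a sigma type so that [eigs] can be a function of the
    matrix. *)
Lemma eigenvalue_seq (C : numClosedFieldType) n (A : 'M[C]_n) :
  {s : seq C | (forall x, \det (1%:M - x *: A) = \prod_(z <- s) (1 - z * x))
    & forall k, \tr (A ^+ k) = \sum_(z <- s) z ^+ k}.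
Proof.
have [n0|n_gt0] := posnP n.
  move: A; rewrite {}n0 => A; exists [::] => [x|k].
    by rewrite det_mx00 big_nil.
  by rewrite /mxtrace big_ord0 big_nil.
have /cid[P /andP[/unitarymx_unit Pu]] : exists P : 'M[C]_n,
    (P \is unitarymx) && similar_trig P A.
  by have [P Pu tP] := Schur A n_gt0; exists P; rewrite Pu.
rewrite /similar_to; set T := conjmx P A => Ttrig.
have eA : A = invmx P *m T *m P.
  by rewrite /T /conjmx pinvmxE // !mulmxA mulVmx // mul1mx -mulmxA mulVmx // mulmx1.
clearbody T.
have eAk k : A ^+ k = invmx P *m T ^+ k *m P.
  elim: k => [|k IH]; first by rewrite !expr0 mulmx1 mulVmx.
  by rewrite exprS IH {1}eA -!mulmxE -!mulmxA (mulKVmx Pu) exprS -mulmxE !mulmxA.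
exists [seq T i i | i <- index_enum 'I_n] => [x|k].
  have -> : 1%:M - x *: A = invmx P *m (1%:M - x *: T) *m P.
    rewrite {1}eA mulmxBr mulmxBl mulmx1 mulVmx //.
    by rewrite -!scalemxAr -!scalemxAl.
  rewrite !det_mulmx mulrAC -det_mulmx mulVmx // det1 mul1r det_trig ?big_map.
    by apply: eq_bigr => i _; rewrite !mxE eqxx mulrC.
  apply/is_trig_mxP => i j lt_ij; move/is_trig_mxP: Ttrig => Ttrig.
  by rewrite !mxE Ttrig // mulr0 subr0 -val_eqE /= ltn_eqF.
rewrite eAk mxtrace_mulC mulmxA mulmxV // mul1mx big_map.
by apply: eq_bigr => i _; have [_ ->] := trig_mxX k Ttrig.
Qed.

(** * Power sums and products of factors 1 - z X^l *)

(* A factor [p] of a product stands for the polynomial [1 - p.1 X^p.2]. *)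
Definition eulerprod (C : nzRingType) (fs : seq (C * nat)) : {poly C} :=
  \prod_(p <- fs) (1 - p.1 *: 'X^(p.2)).

(* The coefficient of [X^(k-1)] in minus the logarithmic derivative of       *)
(* [eulerprod fs].                                                           *)
Definition psum (C : nzRingType) (fs : seq (C * nat)) (k : nat) : C :=
  \sum_(p <- fs | (p.2 %| k)%N) p.2%:R * p.1 ^+ (k %/ p.2).

Definition epos (C : nzRingType) (fs : seq (C * nat)) :=
  all (fun p => 0 < p.2)%N fs.

Section EulerProd.
Variable C : numFieldType.
Implicit Types (fs gs : seq (C * nat)) (P Q : {poly C}).

Lemma horner_eulerprod fs u :
  (eulerprod fs).[u] = \prod_(p <- fs) (1 - p.1 * u ^+ p.2).
Proof.
rewrite /eulerprod horner_prod; apply: eq_bigr => p _.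
by rewrite hornerD hornerN hornerZ hornerXn hornerC.
Qed.

Lemma coef_eulerprod_cons p fs n : (eulerprod (p :: fs))`_n =
  (eulerprod fs)`_n - p.1 * (if (n < p.2)%N then 0 else (eulerprod fs)`_(n - p.2)).
Proof.
by rewrite /eulerprod big_cons mulrBl mul1r coefB -scalerAl coefZ coefXnM.
Qed.

Lemma coef0_eulerprod fs : epos fs -> (eulerprod fs)`_0 = 1.
Proof.
elim: fs => [|p fs IH] /=; first by rewrite /eulerprod big_nil coef1.
by case/andP=> p_gt0 fs_gt0; rewrite coef_eulerprod_cons p_gt0 mulr0 subr0 IH.
Qed.

(** The logarithmic derivative turns products into sums. Its power series is cut at degree [N],
    which leaves the coefficients below [N] intact. *)
Lemma deriv_eulerprod fs N n : epos fs -> (n < N)%N ->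
  (eulerprod fs)^`()`_n =
    - (eulerprod fs * \poly_(k < N) psum fs k.+1)`_n.
Proof.
elim: fs n => [|p fs IH] n /=.
  rewrite /eulerprod big_nil derivC coef0 mul1r coef_poly /psum big_nil.
  by rewrite if_same oppr0.
case/andP=> p_gt0 fs_gt0 ltnN.
pose f k : C := if (p.2 %| k)%N then p.2%:R * p.1 ^+ (k %/ p.2) else 0.
have -> : \poly_(k < N) psum (p :: fs) k.+1 =
    \poly_(k < N) f k.+1 + \poly_(k < N) psum fs k.+1.
  apply/polyP => i; rewrite coefD !coef_poly; case: ifP => _; last by rewrite addr0.
  by rewrite /psum big_cons /f; case: ifP; rewrite ?add0r.
rewrite [eulerprod (p :: fs)]/eulerprod big_cons -/(eulerprod fs).
set E := eulerprod fs; set Q := 1 - _.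
(* For one factor $1-zX^l$ the product telescopes, because $f(k+l)=z f(k)$. The indices start at 1,
   so only $f(l)=lz$ has nothing to cancel. *)
have dQ i : (i < N)%N -> Q^`()`_i = - (Q * \poly_(k < N) f k.+1)`_i.
  move=> ltiN; rewrite /Q derivB derivC sub0r derivZ derivXn coefN coefZ.
  rewrite mulrBl mul1r coefB -scalerAl coefZ coefXnM !coef_poly ltiN.
  rewrite -scaler_nat coefZ coefXn; congr (- _); rewrite /f.
  have [lt_ip|le_pi] := ltnP i p.2.
    rewrite mulr0 subr0; have [eip|nip] := eqVneq i p.2.-1.
      by rewrite eip prednK // dvdnn divnn p_gt0 expr1 mulr1 mulrC.
    rewrite !mulr0; case: ifP => // /(dvdn_leq (ltn0Sn _)) le_pi.
    by case/eqP: nip; apply/eqP; rewrite -eqSS prednK // eqn_leq lt_ip.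
  rewrite gtn_eqF; last by rewrite prednK.
  rewrite (leq_ltn_trans (leq_subr _ _) ltiN) !mulr0.
  have -> : (i.+1 = (i - p.2).+1 + p.2)%N by lia.
  rewrite dvdn_addl ?dvdnn // divnDr // divnn p_gt0 addn1.
  by case: ifP => _; rewrite ?mulr0 ?subrr // exprS mulrCA subrr.
rewrite derivM coefD -/E.
have -> : Q * E * (\poly_(k < N) f k.+1 + \poly_(k < N) psum fs k.+1) =
   (Q * \poly_(k < N) f k.+1) * E + Q * (E * \poly_(k < N) psum fs k.+1) by ring.
rewrite coefD opprD; congr (_ + _).
  rewrite !coefM -sumrN; apply: eq_bigr => i _.
  by rewrite dQ ?mulNr // (leq_trans _ ltnN).
rewrite !coefM -sumrN; apply: eq_bigr => i _.
by rewrite IH ?mulrN // (leq_ltn_trans (leq_subr _ _)).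
Qed.

(** The logarithmic derivative gives $(n+1)a_{n+1}$ in terms of $a_0,\dots,a_n$ and the power sums;
    characteristic zero allows division by $n+1$. *)
Lemma eulerprod_coef_eq fs gs N : epos fs -> epos gs ->
    (forall k, 0 < k <= N -> psum fs k = psum gs k)%N ->
  forall n, (n <= N)%N -> (eulerprod fs)`_n = (eulerprod gs)`_n.
Proof.
move=> fs_gt0 gs_gt0 eq_psum n; have [m] := ubnP n.
elim: m n => // m IH [|n]; first by rewrite !coef0_eulerprod.
rewrite ltnS => lt_nm lt_nN.
have n1_neq0 : n.+1%:R != 0 :> C by rewrite pnatr_eq0.
apply: (mulIf n1_neq0); rewrite !mulr_natr -!coef_deriv.
rewrite (deriv_eulerprod fs_gt0 lt_nN) (deriv_eulerprod gs_gt0 lt_nN).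
rewrite !coefM; congr (- _); apply: eq_bigr => i _.
rewrite IH; [|exact: leq_ltn_trans (leq_ord i) _|exact: leq_trans (leq_ord i) (ltnW _)].
by rewrite !coef_poly; case: ifP => // ltN; rewrite eq_psum.
Qed.

(** * Weighted $\ell^1$ norms of products of factors *)

Definition wsize (r : C) fs := \sum_(p <- fs) `|p.1| * r ^+ p.2.

Lemma wsize_ge0 r fs : 0 <= r -> 0 <= wsize r fs.
Proof. by move=> r0; apply: sumr_ge0 => p _; rewrite mulr_ge0 ?exprn_ge0. Qed.

(** By induction, from $(1+x)(1-x-s)\le 1-s$ for $x,s\ge 0$. *)
Lemma prod_1D_le fs r : 0 <= r ->
  (\prod_(p <- fs) (1 + `|p.1| * r ^+ p.2)) * (1 - wsize r fs) <= 1.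
Proof.
move=> r_ge0; elim: fs => [|p fs IH].
  by rewrite /wsize !big_nil subr0 mulr1.
rewrite /wsize !big_cons -/(wsize r fs); set x := `|p.1| * _.
move: IH; set b := \prod_(_ <- _) _ => IH.
have x0 : 0 <= x by rewrite mulr_ge0 ?exprn_ge0.
have b0 : 0 <= b by apply: prodr_ge0 => q _; rewrite addr_ge0 ?mulr_ge0 ?exprn_ge0.
apply: le_trans IH; rewrite mulrAC [X in _ <= X]mulrC ler_wpM2r //.
rewrite -subr_ge0.
have -> : 1 - wsize r fs - (1 + x) * (1 - (x + wsize r fs)) =
   x * (x + wsize r fs) by ring.
by rewrite mulr_ge0 ?addr_ge0 ?wsize_ge0.
Qed.

(** The norm $\sum_i|a_i|r^i$ is submultiplicative. The cutoff [M] is arbitrary because multiplying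
    by $X^l$ shifts it: the induction hypothesis is used at both [M] and [M - p.2]. *)
Lemma eulerprod_norm fs r M : 0 <= r ->
  \sum_(i < M) `|(eulerprod fs)`_i| * r ^+ i
    <= \prod_(p <- fs) (1 + `|p.1| * r ^+ p.2).
Proof.
move=> r_ge0; elim: fs M => [|p fs IH] M.
  rewrite /eulerprod !big_nil; case: M => [|M]; first by rewrite big_ord0.
  rewrite big_ord_recl /= coef1 normr1 mul1r big1 ?addr0 // => i _.
  by rewrite coef1 normr0 mul0r.
rewrite big_cons.
apply: (@le_trans _ _ (\sum_(i < M) (`|(eulerprod fs)`_i| * r ^+ i)
  + \sum_(i < M) `|p.1| * (if (i < p.2)%N then 0 else
        `|(eulerprod fs)`_(i - p.2)| * r ^+ i))).
  rewrite -big_split /=; apply: ler_sum => i _; rewrite coef_eulerprod_cons.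
  apply: le_trans (ler_wpM2r (exprn_ge0 _ r_ge0) (ler_normB _ _)) _.
  rewrite mulrDl lerD2l normrM -mulrA ler_wpM2l //.
  by case: ifP; rewrite ?normr0 ?mul0r.
rewrite mulrDl mul1r lerD // -mulr_sumr -mulrA ler_wpM2l //.
apply: le_trans (ler_wpM2l (exprn_ge0 _ r_ge0) (IH (M - p.2)%N)).
have [le_Mp|lt_pM] := leqP M p.2.
  rewrite big1 ?mulr_ge0 ?exprn_ge0 ?sumr_ge0 // => [|i _].
    by move=> i _; rewrite mulr_ge0 ?exprn_ge0.
  by rewrite (leq_trans (ltn_ord i)).
have eM := subnKC (ltnW lt_pM); move: (M - p.2)%N eM => m <-.
rewrite big_split_ord /= big1 ?add0r => [|i _]; last first.
  by rewrite ltn_ord.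
rewrite mulr_sumr; apply: ler_sum => i _.
by rewrite ltnNge leq_addr /= addKn exprD mulrCA.
Qed.

(* Past degree [N] the halved radius gains the factor [2^-N].                *)
Lemma eulerprod_close fs gs N r u : epos fs -> epos gs ->
    (forall k, 0 < k <= N -> psum fs k = psum gs k)%N ->
    0 <= r -> wsize r fs <= 2^-1 -> wsize r gs <= 2^-1 -> `|u| <= r / 2 ->
  `|(eulerprod fs).[u] - (eulerprod gs).[u]| <= 4 / 2 ^+ N.
Proof.
move=> fs_gt0 gs_gt0 eq_psum r_ge0 fsr gsr ur.
(* The bound 2 is $1/(1-1/2)$, from [prod_1D_le]. *)
have bound hs M : wsize r hs <= 2^-1 ->
    \sum_(i < M) `|(eulerprod hs)`_i| * r ^+ i <= 2.
  move=> hsr; apply: le_trans (eulerprod_norm hs M r_ge0) _.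
  have := prod_1D_le hs r_ge0; set b := \prod_(_ <- _) _ => b1.
  have b0 : 0 <= b by apply: prodr_ge0 => q _; rewrite addr_ge0 ?mulr_ge0 ?exprn_ge0.
  have h2 : b * 2^-1 <= 1.
    apply: le_trans b1; rewrite ler_wpM2l // lerBrDl.
    by rewrite [leRHS]splitr div1r lerD2r.
  by move: h2; rewrite ler_pdivrMr ?mul1r // ltr0n.
rewrite -hornerN -hornerD horner_coef.
set P := _ - _; apply: le_trans (ler_norm_sum _ _ _) _.
have le_term (i : 'I_(size P)) : `|P`_i * u ^+ i| <=
  (`|(eulerprod fs)`_i| * r ^+ i + `|(eulerprod gs)`_i| * r ^+ i) / 2 ^+ N.
  rewrite -mulrDl /P coefB.
  have [le_iN|lt_Ni] := leqP i N.
    rewrite (eulerprod_coef_eq fs_gt0 gs_gt0 eq_psum) // subrr mul0r normr0.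
    by rewrite !mulr_ge0 ?addr_ge0 ?invr_ge0 ?exprn_ge0.
  rewrite normrM -mulrA ler_pM //; first exact: ler_normB.
  rewrite normrX; apply: le_trans (lerXn2r i _ _ ur) _; rewrite ?nnegrE ?divr_ge0 //.
  rewrite expr_div_n ler_wpM2l ?exprn_ge0 // lef_pV2 ?posrE ?exprn_gt0 //.
  by rewrite ler_eXn2l ?ltr1n // ltnW.
apply: le_trans (ler_sum _ (fun i _ => le_term i)) _.
rewrite -mulr_suml ler_wpM2r ?invr_ge0 ?exprn_ge0 // big_split /=.
by rewrite (_ : 4 = 2 + 2) ?lerD ?bound // -natrD.
Qed.

End EulerProd.
(** * Powers and rotations of words *)

Section SeqPower.
Variable T : eqType.
Implicit Types (r s w : seq T).

(** Convertible to [power s k], but over any type of letters. *)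
Definition repeated k s := flatten (nseq k s).

Lemma repeatedS k s : repeated k.+1 s = s ++ repeated k s.
Proof. by []. Qed.

Lemma size_repeated k s : size (repeated k s) = (k * size s)%N.
Proof. by rewrite size_flatten /shape map_nseq sumn_nseq mulnC. Qed.

Lemma repeatedSr k s : repeated k.+1 s = repeated k s ++ s.
Proof.
elim: k => [|k IH]; first by rewrite repeatedS cats0.
by rewrite repeatedS {1}IH catA.
Qed.

Lemma repeatedM k m s : repeated (k * m) s = repeated k (repeated m s).
Proof.
elim: k => // k IH.
by rewrite mulSn repeatedS -IH /repeated nseqD flatten_cat.
Qed.

Lemma repeated_cat_comm a b k : repeated k (a ++ b) ++ a = a ++ repeated k (b ++ a).
Proof.
elim: k => [|k IH]; first by rewrite cats0.
by rewrite !repeatedS -catA IH -!catA.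
Qed.

Lemma rot_repeated i k s : (i <= size s)%N ->
  rot i (repeated k s) = repeated k (rot i s).
Proof.
move=> le_i; case: k => // k.
have sz : size (take i s) = i by rewrite size_take_min; apply/minn_idPl.
rewrite [RHS]repeatedSr /rot -{1 2}(cat_take_drop i s) [repeated _ _]repeatedS -catA.
rewrite take_size_cat // drop_size_cat // -catA repeated_cat_comm.
by rewrite catA -repeatedS repeatedSr.
Qed.

Lemma take_repeated k s : take (size s) (repeated k.+1 s) = s.
Proof. by rewrite repeatedS take_size_cat. Qed.

Lemma iter_rot1 i s : (i <= size s)%N -> iter i (rot 1) s = rot i s.
Proof.
elim: i => [|i IH] le_i; first by rewrite rot0.
by rewrite iterS IH 1?ltnW // -rotS.
Qed.

(** Bezout, applied to iterates of [rot 1]. The size bounds matter because [rot i] is the identity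
    once [i] exceeds the size. *)
Lemma rot_gcd p q w : (0 < p <= size w)%N -> (q <= size w)%N ->
  rot p w = w -> rot q w = w -> rot (gcdn p q) w = w.
Proof.
case/andP=> p_gt0 le_p le_q; rewrite -!iter_rot1 //; last first.
  by rewrite (leq_trans _ le_p) // dvdn_leq // dvdn_gcdl.
move=> pw qw; have iterK n m : iter n (rot 1) w = w -> iter (m * n) (rot 1) w = w.
  by move=> nw; elim: m => // m IH; rewrite mulSn iterD IH.
have [km kn e _] := egcdnP q p_gt0.
by have := iterK _ km pw; rewrite e addnC iterD iterK.
Qed.

Lemma comm_repeated k a b : size b = (k * size a)%N -> a ++ b = b ++ a ->
  b = repeated k a.
Proof.
elim: k b => [|k IH] b; first by move/size0nil->.
move=> szb ab; have e : take (size a) b = a.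
  have /(congr1 (take (size a))) := ab.
  by rewrite take_size_cat // takel_cat // szb mulSn leq_addr.
rewrite repeatedS -{1}(cat_take_drop (size a) b) e; congr (_ ++ _).
apply: IH; first by rewrite size_drop szb mulSn addKn.
move: ab; rewrite -{1 2}(cat_take_drop (size a) b) e -catA => /eqP.
by rewrite eqseq_cat // eqxx => /eqP.
Qed.

Lemma rot_fix_repeated p w : (0 < p)%N -> (p %| size w)%N -> rot p w = w ->
  w = repeated (size w %/ p) (take p w).
Proof.
move=> p_gt0 /dvdnP[[|k] ek] pw; first by rewrite (size0nil ek) div0n.
have le_p : (p <= size w)%N by rewrite ek mulSn leq_addr.
have szt : size (take p w) = p by rewrite size_take_min; apply/minn_idPl.
rewrite ek mulnK // repeatedS -{1}(cat_take_drop p w); congr (_ ++ _).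
apply: comm_repeated; first by rewrite size_drop ek szt mulSn addKn.
by rewrite cat_take_drop -[LHS]pw.
Qed.

Definition aperiodic s := s <> [::] /\ forall r k, (2 <= k)%N -> s <> repeated k r.

Lemma aperiodic_size s : aperiodic s -> (0 < size s)%N.
Proof. by case: s => [[]|]. Qed.

Lemma aperiodic_rot_dvd s p : aperiodic s -> (0 < p)%N -> (p %| size s)%N ->
  rot p s = s -> p = size s.
Proof.
move=> ap p_gt0 p_dvd /(rot_fix_repeated p_gt0 p_dvd) es; apply/eqP.
have s_gt0 := aperiodic_size ap.
rewrite eqn_leq dvdn_leq //= leqNgt; apply/negP => lt_ps.
case: ap => _ /(_ _ _ _ es); apply.
have /dvdnP[k ek] := p_dvd; move: lt_ps; rewrite ek mulnK //.
by case: k {ek} => [|[|]]; rewrite ?mul1n ?ltnn.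
Qed.

(** The common word is fixed by rotation by both lengths, hence by their gcd. Restricting to
    prefixes, [r] and [s] are fixed by it too, so aperiodicity forces both lengths to equal the
    gcd. *)
Lemma aperiodic_repeated_inj r s k m : aperiodic r -> aperiodic s ->
  (0 < k)%N -> (0 < m)%N -> repeated k r = repeated m s -> r = s.
Proof.
move=> apr aps; case: k => // k; case: m => // m _ _ ers.
have szr := aperiodic_size apr; have szs := aperiodic_size aps.
set w := repeated k.+1 r in ers.
have rw : rot (size r) w = w by rewrite rot_repeated // rot_size.
have sw : rot (size s) w = w by rewrite ers rot_repeated // rot_size.
have gw : rot (gcdn (size r) (size s)) w = w.
  apply: rot_gcd => //; first by rewrite szr size_repeated mulSn leq_addr.
  by rewrite ers size_repeated mulSn leq_addr.
have g_gt0 : (0 < gcdn (size r) (size s))%N by rewrite gcdn_gt0 szr.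
have primroot t n : aperiodic t -> (0 < size t)%N -> w = repeated n.+1 t ->
    (gcdn (size r) (size s) %| size t)%N -> gcdn (size r) (size s) = size t.
  move=> apt szt et gt; apply: aperiodic_rot_dvd => //.
  move/(congr1 (take (size t))): gw; rewrite et rot_repeated ?(dvdn_leq szt gt) //.
  by rewrite -{1}(size_rot (gcdn (size r) (size s)) t) !take_repeated.
have gr := primroot r k apr szr erefl (dvdn_gcdl _ _).
have gs := primroot s m aps szs ers (dvdn_gcdr _ _).
by have := take_repeated k r; rewrite -/w ers -gr gs take_repeated.
Qed.

Lemma aperiodic_rot_inj s i j : aperiodic s -> (i < size s)%N -> (j < size s)%N ->
  rot i s = rot j s -> i = j.
Proof.
move=> ap; wlog le_ij : i j / (i <= j)%N => [hw lt_i lt_j eij|].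
  by case/orP: (leq_total i j) => le; [|apply/esym]; exact: hw.
move=> lt_i lt_j; rewrite -{1}(subnKC le_ij) rotD ?(subnKC le_ij) ?(ltnW lt_j) //.
move=> /rot_inj /esym es; apply/eqP; rewrite eqn_leq le_ij /= -subn_eq0.
have s_gt0 := aperiodic_size ap.
have lt_d : (j - i < size s)%N := leq_ltn_trans (leq_subr _ _) lt_j.
(* Now [s] is fixed by rotation by [j - i]; as its size would then divide [j - i], which is smaller,
   the difference is 0. *)
have : gcdn (size s) (j - i) = size s.
  apply: aperiodic_rot_dvd; rewrite ?gcdn_gt0 ?s_gt0 ?dvdn_gcdl //.
  by apply: rot_gcd; rewrite ?s_gt0 ?leqnn ?rot_size // ltnW.
have [-> //|d_gt0] := posnP (j - i).
move=> e; have := dvdn_leq d_gt0 (dvdn_gcdr (size s) (j - i)).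
by rewrite e leqNgt lt_d.
Qed.

Lemma aperiodic_rot s i : aperiodic s -> aperiodic (rot i s).
Proof.
case=> s0 aps; split=> [/(congr1 size)|r k k2 e].
  by rewrite size_rot => /size0nil.
have r_gt0 : (0 < size r)%N.
  case: r e => // /(congr1 size); rewrite size_rot size_repeated muln0 => /size0nil.
  by [].
(* Undoing the rotation may take more than [size r] steps, beyond the range of [rot_repeated], so it
   is done one step at a time. *)
have rot1 n : iter n (rot 1) (repeated k r) = repeated k (iter n (rot 1) r).
  elim: n => //= n ->; rewrite rot_repeated //.
  by elim: n => //= n; rewrite size_rot.
apply: (aps (iter (size s - i) (rot 1) r) k k2).
rewrite -rot1 iter_rot1 -e ?size_rot ?leq_subr //.
by rewrite -[in LHS](rotK i s) /rotr size_rot.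
Qed.

Lemma repeated_aperiodic w : w <> [::] ->
  exists r k, [/\ (0 < k)%N, aperiodic r & w = repeated k r].
Proof.
have [n] := ubnP (size w); elim: n w => // n IH w.
rewrite ltnS => szw w0.
have [ap|nap] := pselect (aperiodic w).
  by exists w, 1%N; split=> //; rewrite /repeated /= cats0.
have [r [k [k2 ew]]] : exists r k, (2 <= k)%N /\ w = repeated k r.
  apply: contrapT => nex; apply: nap; split=> // r k k2 e; apply: nex.
  by exists r, k.
have r0 : r <> [::].
  by move=> r0; apply: w0; apply: size0nil; rewrite ew r0 size_repeated muln0.
have lt_rw : (size r < size w)%N.
  rewrite ew size_repeated -[X in (X < _)%N]mul1n ltn_pmul2r //.
  by case: (r) r0.
have [s [m [m_gt0 aps er]]] := IH r (leq_trans lt_rw szw) r0.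
exists s, (k * m)%N; split=> //; first by rewrite muln_gt0 m_gt0 andbT ltnW.
by rewrite ew er repeatedM.
Qed.

Lemma all_repeated (p : pred T) k s : (0 < k)%N -> all p (repeated k s) = all p s.
Proof.
case: k => // k _; elim: k => [|k IH]; first by rewrite /repeated /= cats0.
by rewrite repeatedS all_cat IH andbb.
Qed.

Lemma cycle_repeated (e : rel T) k s : (0 < k)%N ->
  path.cycle e (repeated k s) = path.cycle e s.
Proof.
case: k => // k _; elim: k => [|k IH]; first by rewrite /repeated /= cats0.
move: IH; case: s => [|x s] IH; first by rewrite repeatedS.
have cat_cycle t : path.cycle e ((x :: s) ++ x :: t) =
    path.cycle e (x :: s) && path.cycle e (x :: t).
  by rewrite /= rcons_cat cat_path /= -[in RHS]cats1 cat_path /= andbT andbA.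
by rewrite repeatedS repeatedS cat_cycle -cat_cons -repeatedS IH andbb.
Qed.

Fixpoint words_over (A : seq T) n : seq (seq T) :=
  if n is m.+1 then [seq x :: w | x <- A, w <- words_over A m] else [:: [::]].

Lemma words_overS A n :
  words_over A n.+1 = [seq x :: w | x <- A, w <- words_over A n].
Proof. by []. Qed.

Lemma size_words_over A n : size (words_over A n) = (size A ^ n)%N.
Proof. by elim: n => // n IH; rewrite words_overS size_allpairs IH expnS. Qed.

Lemma words_over_uniq A n : uniq A -> uniq (words_over A n).
Proof.
move=> uA; elim: n => // n IH; apply: allpairs_uniq => //.
by move=> [x w] [y v] _ _ /= [-> ->].
Qed.

Lemma mem_words_over A n w :
  (w \in words_over A n) = (size w == n) && all (mem A) w.
Proof.
elim: n w => [|n IH] [|x w] //=.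
  by apply/allpairsP => -[[y v] /= []].
rewrite eqSS andbCA -IH; apply/allpairsP/andP => [[[y v] /= [? ? [-> ->]]]|[xA wn]] //.
by exists (x, w).
Qed.

End SeqPower.

Arguments words_over : simpl never.

(** * Closed reduced paths and primes *)

Section Primes.
Variables (gT : finGroupType) (X : graph_of_groups gT).
Implicit Types (Q R : word X) (s t : gT * hedge X).

Definition in_vgroup s := s.1 \in vgroup (Defs.root s.2).

(** Joins linkage and reducedness into one condition on neighbouring letters, so that closed reduced
    paths are cycles of a relation, stable under rotations and powers. *)
Definition follows s t :=
  linked s.2 t.2 && ((t.2 != bar s.2) || (t.1 != 1%g)).

Definition reduced_cycle Q :=
  [&& Q != [::], all in_vgroup Q & path.cycle follows Q].

Lemma reduced_cycleE Q : closed_path Q && reduced Q = reduced_cycle Q.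
Proof.
have cycleI (e1 e2 : rel (gT * hedge X)) Q' :
    path.cycle [rel s t | e1 s t && e2 s t] Q' = path.cycle e1 Q' && path.cycle e2 Q'.
  by case: Q' => //= x p; rewrite path_relI.
rewrite /closed_path /gog_path /reduced /reduced_cycle -/in_vgroup.
rewrite [path.cycle follows Q]cycleI -!andbA; congr [&& _, _ & _].
case: Q => //= x p; rewrite rcons_path.
by case: (path _ x p) => //=; rewrite andbF.
Qed.

Lemma reduced_cycle_repeated k Q : (0 < k)%N ->
  reduced_cycle (repeated k Q) = reduced_cycle Q.
Proof.
move=> k_gt0; rewrite /reduced_cycle all_repeated // cycle_repeated //.
by rewrite -!size_eq0 size_repeated muln_eq0 (gtn_eqF k_gt0).
Qed.

Lemma reduced_cycle_rot i Q : reduced_cycle (rot i Q) = reduced_cycle Q.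
Proof.
by rewrite /reduced_cycle -!size_eq0 size_rot rot_cycle
  (perm_all _ (permEl (perm_rot i Q))).
Qed.

(** If a closed reduced path is $R^k$ with $k\ge 2$, then $R$ is itself closed and reduced, in
    particular a path; so primitivity is aperiodicity of the word. *)
Lemma primitiveP Q : primitive Q <-> reduced_cycle Q /\ aperiodic Q.
Proof.
split=> [[cQ rQ pQ]|[rcQ [Q0 pQ]]].
  have rcQ : reduced_cycle Q by rewrite -reduced_cycleE cQ rQ.
  split=> //; split=> [Q0|R k k2 eQ]; first by rewrite Q0 in rcQ.
  apply: (pQ R k k2 _ eQ); move: rcQ; rewrite eQ reduced_cycle_repeated 1?ltnW //.
  by rewrite -reduced_cycleE => /andP[/andP[]].
by move: rcQ; rewrite -reduced_cycleE => /andP[cQ rQ]; split=> // R k k2 _; exact: pQ.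
Qed.

Lemma prime_rep_primitive (q : prime_path X) : primitive (prime_rep q).
Proof. exact/asboolP/(valP (generic_quotient.repr q)). Qed.

Lemma prime_repP (q : prime_path X) :
  reduced_cycle (prime_rep q) /\ aperiodic (prime_rep q).
Proof. exact/primitiveP/prime_rep_primitive. Qed.

Lemma size_prime_rep_gt0 (q : prime_path X) : (0 < size (prime_rep q))%N.
Proof. by have [_ /aperiodic_size] := prime_repP q. Qed.

Lemma prime_rep_ex Q : primitive Q ->
  exists (q : prime_path X) i,
    (i < size (prime_rep q))%N /\ Q = rot i (prime_rep q).
Proof.
move=> pQ; have bQ : `[< primitive Q >] by apply/asboolP.
pose P : primitive_word X := exist _ Q bQ.
pose q : prime_path X := \pi%qT P; exists q.
have : P = generic_quotient.repr q %[mod prime_path X]%qT by rewrite reprK.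
move=> /esym/eqmodP/asboolP[n eQ].
have [lt_n|le_n] := ltnP n (size (prime_rep q)); first by exists n.
by exists 0%N; rewrite size_prime_rep_gt0 rot0 -[LHS]/(val P) eQ rot_oversize.
Qed.

Lemma prime_rep_inj (q q' : prime_path X) i j :
  rot i (prime_rep q) = rot j (prime_rep q') -> q = q'.
Proof.
move=> e; have [rcq apq] := prime_repP q.
have bQ : `[< primitive (rot i (prime_rep q)) >].
  apply/asboolP/primitiveP; rewrite reduced_cycle_rot.
  by split=> //; exact: aperiodic_rot.
pose P : primitive_word X := exist _ (rot i (prime_rep q)) bQ.
transitivity (\pi%qT P : prime_path X); last symmetry;
  rewrite -[LHS]reprK; apply/eqmodP/asboolP.
  by exists i.
by exists j.
Qed.

Definition cyclic_words n :=
  [seq Q <- words_over (enum {: gT * hedge X}) n | reduced_cycle Q].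

Lemma mem_cyclic_words n Q : (Q \in cyclic_words n) = (size Q == n) && reduced_cycle Q.
Proof.
rewrite mem_filter mem_words_over andbC; case: (size Q == n) => //=.
by rewrite (_ : all _ Q = true) //; apply/allP => s _ /=; rewrite mem_enum.
Qed.

(** Existence of an aperiodic root gives surjectivity. For injectivity, the root is unique, it
    determines its prime, and the rotations of an aperiodic word are distinct. [A] is any finite
    supply of primes containing the short ones. *)
Lemma perm_cyclic_words (A : seq (prime_path X)) n : (0 < n)%N -> uniq A ->
    (forall q, (size (prime_rep q) <= n)%N -> q \in A) ->
  perm_eq (cyclic_words n)
    [seq rot i (repeated (n %/ size (prime_rep q)) (prime_rep q)) |
      q <- [seq q <- A | (size (prime_rep q) %| n)%N],
      i <- iota 0 (size (prime_rep q))].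
Proof.
move=> n_gt0 uA memA; apply: uniq_perm.
- by rewrite filter_uniq // words_over_uniq ?enum_uniq.
- have div_gt0 (q : prime_path X) : (size (prime_rep q) %| n)%N ->
      (0 < n %/ size (prime_rep q))%N.
    by move=> qn; rewrite divn_gt0 ?size_prime_rep_gt0 // dvdn_leq.
  apply: allpairs_uniq_dep => [||[q i] [q' j]]; rewrite ?filter_uniq //.
    by move=> q _; exact: iota_uniq.
  move=> /allpairsPdep[q1 [i1 [+ + [-> ->]]]] /allpairsPdep[q2 [i2 [+ + [-> ->]]]].
  rewrite !mem_filter !mem_iota /= => {q i q' j} /andP[q1n _] lt1 /andP[q2n _] lt2.
  have [[_ ap1] [_ ap2]] := (prime_repP q1, prime_repP q2).
  rewrite !rot_repeated 1?ltnW // => e.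
  have e12 := aperiodic_repeated_inj (aperiodic_rot i1 ap1) (aperiodic_rot i2 ap2)
    (div_gt0 q1 q1n) (div_gt0 q2 q2n) e.
  have eq12 := prime_rep_inj e12; move: lt2 e12; rewrite -eq12 => lt2 e12.
  by rewrite (aperiodic_rot_inj ap1 lt1 lt2 e12).
move=> Q; rewrite mem_cyclic_words; apply/andP/allpairsPdep; last first.
  case=> q [i [+ + ->]]; rewrite mem_filter mem_iota /= => /andP[qn _] lt_i.
  have [rcq _] := prime_repP q.
  rewrite size_rot size_repeated divnK // reduced_cycle_rot reduced_cycle_repeated //.
  by rewrite divn_gt0 ?size_prime_rep_gt0 // dvdn_leq.
case=> /eqP szQ rcQ.
have Q0 : Q <> [::] by move=> Q0; rewrite Q0 in rcQ.
have [R [k [k_gt0 apR eQ]]] := repeated_aperiodic Q0.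
have rcR : reduced_cycle R by move: rcQ; rewrite eQ reduced_cycle_repeated.
have /prime_rep_ex[q [i [lt_i eR]]] : primitive R by apply/primitiveP.
have en : n = (k * size (prime_rep q))%N by rewrite -szQ eQ size_repeated eR size_rot.
exists q, i; rewrite mem_filter mem_iota /= en dvdn_mull //.
rewrite memA ?en ?leq_pmull // mulnK ?size_prime_rep_gt0 //.
by rewrite (rot_repeated _ (ltnW lt_i)) -eR.
Qed.

End Primes.

(** * Traces of powers of W_rho *)

Section Traces.
Variables (gT : finGroupType) (X : graph_of_groups gT) (F : hedge X -> gT).
Variables (C : numFieldType) (d : nat) (rho : mx_representation C [set: gT] d).
Implicit Types (w : word X) (s t : gT * hedge X).

Lemma repr_mulg x y : rho (x * y)%g = rho x *m rho y.
Proof. by rewrite repr_mxM ?inE. Qed.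

Lemma repr_expg x k : rho (x ^+ k)%g = rho x ^+ k.
Proof.
elim: k => [|k IH]; first by rewrite repr_mx1.
by rewrite expgS repr_mulg IH exprS.
Qed.

Lemma frobenius_repeated k w : frobenius F (repeated k w) = (frobenius F w ^+ k)%g.
Proof.
elim: k => [|k IH]; first by rewrite /frobenius big_nil.
by rewrite repeatedS expgS -IH /frobenius big_cat.
Qed.

Lemma trace_frobenius_rot i w :
  \tr (rho (frobenius F (rot i w))) = \tr (rho (frobenius F w)).
Proof.
have [x ->] := frobenius_rot F i w.
by rewrite conjgE !repr_mulg mxtrace_mulC -mulmxA -!repr_mulg mulgV mulg1.
Qed.

Lemma W_blockE h h' : W_block F rho h h' =
  \sum_(g | in_vgroup (g, h') && follows (1%g, h) (g, h')) rho (g * F h')%g.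
Proof.
have sumE (P : pred gT) h0 : (\sum_(g | P g) rho g) *m rho (F h0) =
    \sum_(g | P g) rho (g * F h0)%g.
  by rewrite mulmx_suml; apply: eq_bigr => g _; rewrite repr_mulg.
rewrite /W_block /follows /in_vgroup /linked /=; have [->|nbar] := eqVneq h' (bar h).
  (* Subtracting $I_d$ removes exactly the term $g=1$, the forbidden backtracking. *)
  rewrite /c_rho (bigD1 1%g) ?group1 //= repr_mx1 [1%:M + _]addrC addrK sumE.
  by apply: eq_bigl => g; rewrite eqxx.
rewrite eq_sym; case: eqP => _ /=; last by rewrite big1 // => g /andP[].
by rewrite sumE; apply: eq_bigl => g; rewrite andbT.
Qed.

(* Only the half-edge of the initial letter [(1, h)] matters: [h] itself is   *)
(* not part of the paths summed over.                                        *)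
Definition path_sum n h h' : 'M[C]_d :=
  \sum_(w <- words_over (enum {: gT * hedge X}) n |
      [&& all (@in_vgroup _ X) w, path.path (@follows _ X) (1%g, h) w
        & (last (1%g, h) w).2 == h'])
    rho (frobenius F w).

Lemma path_sum0 h h' : path_sum 0 h h' = if h == h' then 1%:M else 0.
Proof.
rewrite /path_sum /words_over big_cons big_nil /= addr0.
by case: eqP => // _; rewrite /frobenius big_nil repr_mx1.
Qed.

Lemma path_sumS n h h' :
  path_sum n.+1 h h' = \sum_h1 W_block F rho h h1 *m path_sum n h1 h'.
Proof.
have frob_cons s w : rho (frobenius F (s :: w)) =
    rho (s.1 * F s.2)%g *m rho (frobenius F w).
  by rewrite /frobenius big_cons repr_mulg.
transitivity (\sum_s if in_vgroup s && follows (1%g, h) s then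
    rho (s.1 * F s.2)%g *m path_sum n s.2 h' else 0).
  rewrite [LHS]big_mkcond [LHS]big_allpairs_dep big_enum /=; apply: eq_bigr => s _.
  case: ifP => [/andP[sv hs]|nhs]; last first.
    rewrite big1 // => w _; case: ifP => // /and3P[/andP[sv _] /andP[hs _] _].
    by rewrite sv hs in nhs.
  rewrite /path_sum mulmx_sumr [RHS]big_mkcond; apply: eq_bigr => w _.
  by rewrite sv hs frob_cons; case: w.
rewrite -(pair_big xpredT xpredT (fun g h1 => if in_vgroup (g, h1) &&
  follows (1%g, h) (g, h1) then rho (g * F h1)%g *m path_sum n h1 h' else 0)) /=.
rewrite exchange_big /=; apply: eq_bigr => h1 _.
by rewrite W_blockE mulmx_suml [RHS]big_mkcond.
Qed.

Lemma W_rhoX n : W_rho F rho ^+ n.+1 =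
  \mxblock_(i < #|hedge X|, j < #|hedge X|) path_sum n.+1 (enum_val i) (enum_val j).
Proof.
elim: n => [|n IH].
  rewrite expr1; apply: eq_mxblock => i j; rewrite path_sumS.
  rewrite (bigD1 (enum_val j)) //= path_sum0 eqxx mulmx1 big1 ?addr0 // => h1 nh1.
  by rewrite path_sum0 (negPf nh1) mulmx0.
rewrite exprS IH -mulmxE mul_mxblock; apply: eq_mxblock => i j.
by rewrite [RHS]path_sumS (big_enum_val (fun h1 => W_block F rho _ h1 *m _)).
Qed.

Lemma trace_W_rhoX n : (0 < n)%N -> \tr (W_rho F rho ^+ n) =
  \sum_(w <- cyclic_words X n) \tr (rho (frobenius F w)).
Proof.
case: n => // n _; rewrite W_rhoX mxtrace_mxblock.
rewrite -(big_enum_val (fun h => \tr (path_sum n.+1 h h))) /=.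
rewrite /path_sum; under eq_bigr do rewrite raddf_sum /= big_mkcond /=.
rewrite exchange_big /cyclic_words big_filter [RHS]big_mkcond /=.
apply: eq_big_seq => w; rewrite mem_words_over => /andP[szw _].
(* A word lies in the diagonal block of its last half-edge only. Since [follows] ignores the group
   element of its first argument, starting from [(1, h)] is the same as closing the cycle. *)
case: w szw => // s w _; rewrite (bigD1 (last s w).2) //= big1 ?addr0 => [|h nh].
  rewrite eqxx andbT /reduced_cycle /= rcons_path [in RHS]andbC.
  by congr (if _ then _ else _); rewrite andbC -!andbA; do ?bool_congr.
by rewrite eq_sym (negPf nh) !andbF.
Qed.

Lemma trace_W_rhoX_primes (A : seq (prime_path X)) n : (0 < n)%N -> uniq A ->
    (forall q, (size (prime_rep q) <= n)%N -> q \in A) ->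
  \tr (W_rho F rho ^+ n) =
  \sum_(q <- A | (size (prime_rep q) %| n)%N) (size (prime_rep q))%:R *
    \tr (rho (frobenius F (prime_rep q)) ^+ (n %/ size (prime_rep q))).
Proof.
move=> n_gt0 uA memA; rewrite trace_W_rhoX //.
rewrite (perm_big _ (perm_cyclic_words n_gt0 uA memA)) /=.
rewrite big_allpairs_dep big_filter; apply: eq_bigr => q _.
under eq_bigr do rewrite trace_frobenius_rot frobenius_repeated repr_expg.
by rewrite big_const_seq count_predT size_iota iter_addr_0 mulr_natl.
Qed.

End Traces.

(** * Convergence of the Euler product *)

Lemma eulerprod_neq0 (C : numFieldType) (fs : seq (C * nat)) r u :
  0 <= r -> `|u| <= r -> wsize r fs <= 2^-1 -> (eulerprod fs).[u] != 0.
Proof.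
move=> r_ge0 ur fsr; rewrite horner_eulerprod; move: fsr.
elim: fs => [|p fs IH]; first by rewrite big_nil oner_neq0.
rewrite /wsize !big_cons -/(wsize r fs) => le_half.
have pr_ge0 : 0 <= `|p.1| * r ^+ p.2 by rewrite mulr_ge0 ?exprn_ge0.
rewrite mulf_neq0 ?IH //; last by apply: le_trans le_half; rewrite lerDr.
rewrite subr_eq0; apply: contraTneq (le_half) => e1; rewrite lt_geF //.
apply: (@lt_le_trans _ _ 1); first by rewrite invf_lt1 ?ltr1n.
apply: (@le_trans _ _ (`|p.1| * r ^+ p.2)); last by rewrite lerDl wsize_ge0.
by rewrite -(normr1 C) e1 normrM normrX ler_wpM2l // lerXn2r ?nnegrE.
Qed.

Lemma sum_geom_le (C : numFieldType) (x : C) n : 0 <= x <= 2^-1 ->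
  \sum_(i < n) x ^+ i.+1 <= x *+ 2.
Proof.
case/andP=> x_ge0 le_x; elim: n => [|n IH].
  by rewrite big_ord0 mulrn_wge0.
rewrite big_ord_recl expr1 mulr2n lerD2l.
rewrite (eq_bigr (fun i : 'I_n => x * x ^+ i.+1)) => [|i _]; last by rewrite -exprS.
rewrite -mulr_sumr; apply: le_trans (ler_wpM2l x_ge0 IH) _.
rewrite -[leRHS]mulr1 ler_wpM2l // -mulr_natr.
by rewrite -ler_pdivlMr ?ltr0n // mul1r.
Qed.

Section EulerProduct.
Variables (gT : finGroupType) (X : graph_of_groups gT) (F : hedge X -> gT).
Variables (C : numClosedFieldType) (d : nat).
Variable rho : mx_representation C [set: gT] d.
Implicit Type A : seq (prime_path X).

Let ell (q : prime_path X) := size (prime_rep q).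
Let letters := #|{: gT * hedge X}|.

(** Primes of length $n$ have distinct representatives among the [letters ^ n] words, so a geometric
    series bounds the sum independently of [A]. *)
Lemma sum_prime_le A (r : C) : uniq A -> 0 <= r -> letters%:R * r <= 2^-1 ->
  \sum_(q <- A) r ^+ ell q <= (letters%:R * r) *+ 2.
Proof.
move=> uA r_ge0 le_half; pose K := \max_(q <- A) ell q.
have le_K q : q \in A -> (ell q <= K)%N by move=> qA; exact: leq_bigmax_seq.
rewrite (eq_big_seq (fun q => \sum_(n < K) if ell q == n.+1 then r ^+ n.+1 else 0));
  last first.
  move=> q /le_K; have := size_prime_rep_gt0 q; rewrite -/(ell q).
  case: (ell q) => // n _ lt_n; rewrite (bigD1 (Ordinal lt_n)) //= eqxx big1 ?addr0 //.
  by move=> m; rewrite -val_eqE eqSS eq_sym /= => /negPf->.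
rewrite exchange_big /=; apply: le_trans (sum_geom_le K _); last first.
  by rewrite le_half mulr_ge0.
apply: ler_sum => n _; rewrite -big_mkcond big_const_seq iter_addr_0.
rewrite -[leLHS]mulr_natl exprMn -natrX ler_wpM2r ?exprn_ge0 // ler_nat -size_filter.
rewrite -(size_map (@prime_rep _ X)) /letters cardE -size_words_over.
apply: uniq_leq_size.
  rewrite map_inj_uniq ?filter_uniq // => q q' e.
  by apply: (@prime_rep_inj _ _ q q' 0 0); rewrite !rot0.
move=> _ /mapP[q + ->]; rewrite mem_filter => /andP[szq _].
by rewrite mem_words_over szq; apply/allP => s _; rewrite /= mem_enum.
Qed.

Let eigs n (M : 'M[C]_n) := s2val (eigenvalue_seq M).

Let prime_factors A : seq (C * nat) :=
  [seq (z, ell q) | q <- A, z <- eigs (rho (frobenius F (prime_rep q)))].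

Let W_factors : seq (C * nat) := [seq (z, 1%N) | z <- eigs (W_rho F rho)].

Lemma horner_prime_factors A u :
  (eulerprod (prime_factors A)).[u] = \prod_(q <- A) euler_factor F rho u q.
Proof.
rewrite horner_eulerprod big_allpairs_dep; apply: eq_bigr => q _.
by rewrite /euler_factor (s2valP (eigenvalue_seq _)).
Qed.

Lemma horner_W_factors u :
  (eulerprod W_factors).[u] = \det (1%:M - u *: W_rho F rho).
Proof.
rewrite horner_eulerprod big_map (s2valP (eigenvalue_seq _)).
by apply: eq_bigr => z _; rewrite expr1.
Qed.

(** Both power sums equal $\mathrm{tr}\,W_\rho^n$. *)
Lemma psum_prime_factors A n : (0 < n)%N -> uniq A ->
    (forall q, (ell q <= n)%N -> q \in A) ->
  psum (prime_factors A) n = psum W_factors n.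
Proof.
move=> n_gt0 uA memA; transitivity (\tr (W_rho F rho ^+ n)).
  rewrite (trace_W_rhoX_primes _ _ n_gt0 uA memA) /psum big_mkcond [RHS]big_mkcond.
  rewrite big_allpairs_dep /=; apply: eq_bigr => q _; rewrite -/(ell q).
  case: ifP => _; last by rewrite big1.
  by rewrite -mulr_sumr (s2valP' (eigenvalue_seq _)).
rewrite (s2valP' (eigenvalue_seq _)) /psum big_map.
by apply: eq_big => z; rewrite ?dvd1n // divn1 mul1r.
Qed.

Lemma wsize_radius : exists2 r : C, 0 < r &
  wsize r W_factors <= 2^-1 /\ forall A, uniq A -> wsize r (prime_factors A) <= 2^-1.
Proof.
pose B : C := \sum_(x : gT) \sum_(z <- eigs (rho x)) `|z|.
pose L : C := \sum_(z <- eigs (W_rho F rho)) `|z|.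
have B_ge0 : 0 <= B by apply: sumr_ge0 => x _; apply: sumr_ge0.
have L_ge0 : 0 <= L by apply: sumr_ge0.
have a_ge0 : 0 <= letters%:R :> C by rewrite ler0n.
(* The radius is $1/K$. The term [2 * L] handles the eigenvalues of $W_\rho$. The other term
   dominates both [2 * letters], as [sum_prime_le] requires, and [4 * letters * B], for the primes;
   [B] bounds the eigenvalue sums uniformly because the group is finite. *)
pose K : C := 4 * ((letters%:R + 1) * (B + 1)) + 2 * L.
have aB_gt0 : 0 < (letters%:R + 1) * (B + 1) by rewrite mulr_gt0 ?ltr_wpDl.
have K_gt0 : 0 < K by rewrite /K ltr_wpDr ?mulr_ge0 ?(mulr_gt0 _ aB_gt0) ?ler0n ?ltr0n.
have le_half x : x *+ 2 <= K -> x * K^-1 <= 2^-1.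
  by move=> xK; rewrite ler_pdivrMr // ler_pdivlMl ?ltr0n // mulr_natl.
have KV_ge0 : 0 <= K^-1 by rewrite invr_ge0 ltW.
have le_aB : letters%:R <= (letters%:R + 1) * (B + 1).
  by rewrite -[leLHS]mulr1 ler_pM ?ler01 ?lerDl ?lerDr.
exists K^-1; rewrite ?invr_gt0 //; split=> [|A uA].
  rewrite /wsize big_map -mulr_suml le_half // -[_ *+ 2]mulr_natl /K lerDr.
  by rewrite mulr_ge0 // ltW.
have -> : wsize K^-1 (prime_factors A) =
    \sum_(q <- A) (\sum_(z <- eigs (rho (frobenius F (prime_rep q)))) `|z|)
      * K^-1 ^+ ell q.
  by rewrite /wsize big_allpairs_dep; apply: eq_bigr => q _; rewrite -mulr_suml.
apply: (@le_trans _ _ (B * ((letters%:R * K^-1) *+ 2))).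
  apply: le_trans (ler_wpM2l B_ge0 (sum_prime_le uA KV_ge0 _)).
    rewrite mulr_sumr; apply: ler_sum => q _; rewrite ler_wpM2r ?exprn_ge0 //.
    rewrite /B (bigD1 (frobenius F (prime_rep q))) //= lerDl.
    by apply: sumr_ge0 => x _; apply: sumr_ge0.
  apply: le_half; rewrite -[_ *+ 2]mulr_natl /K ler_wpDr ?mulr_ge0 //.
  by rewrite ler_pM ?ler_nat.
rewrite -mulrnAl mulrA le_half // -[_ *+ 2]mulr_natl /K ler_wpDr ?mulr_ge0 //.
have -> : 2 * (B * (letters%:R *+ 2)) = 4 * (letters%:R * B).
  by rewrite -[letters%:R *+ 2]mulr_natl; ring.
by rewrite ler_wpM2l // ler_pM // lerDl.
Qed.

Lemma euler_product_close : exists2 r : C, 0 < r & forall u, `|u| <= r ->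
  [/\ forall q, euler_factor F rho u q != 0,
      \det (1%:M - u *: W_rho F rho) != 0 &
      forall A N, uniq A -> (forall q, (ell q <= N)%N -> q \in A) ->
        `|\prod_(q <- A) euler_factor F rho u q - \det (1%:M - u *: W_rho F rho)|
          <= 4 / 2 ^+ N].
Proof.
have [r r_gt0 [Wr Ar]] := wsize_radius; exists (r / 2); first by rewrite divr_gt0.
have r_ge0 := ltW r_gt0; move=> u ur.
have le_ur : `|u| <= r.
  by apply: le_trans ur _; rewrite ler_pdivrMr ?ltr0n // ler_peMr ?ler1n.
split=> [q||A N uA memA].
(* A single Euler factor is the product over a one-element list. *)
- rewrite -[euler_factor _ _ _ _](big_seq1 *%R) -horner_prime_factors.
  by rewrite (eulerprod_neq0 r_ge0) ?Ar.
- by rewrite -horner_W_factors (eulerprod_neq0 r_ge0).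
rewrite -horner_prime_factors -horner_W_factors.
apply: (eulerprod_close _ _ _ r_ge0 (Ar A uA) Wr ur).
- apply/allP => p /allpairsPdep[q [z [_ _ ->]]]; exact: size_prime_rep_gt0.
- by apply/allP => p /mapP[z _ ->].
move=> k /andP[k_gt0 le_kN]; apply: psum_prime_factors => // q le_q.
by apply: memA; apply: leq_trans le_kN.
Qed.

Lemma primes_fset N :
  exists A : {fset prime_path X}, forall q, (ell q <= N)%N -> q \in A.
Proof.
pose ws := [seq w | n <- iota 0 N.+1, w <- words_over (enum {: gT * hedge X}) n].
pose A := [seq (\pi%qT P : prime_path X) | P <- pmap insub ws : seq (primitive_word X)].
exists [fset q in A]%fset => q le_q; rewrite inE /=; apply/mapP.
exists (generic_quotient.repr q); last by rewrite reprK.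
rewrite mem_pmap_sub; apply/allpairsPdep; exists (ell q), (prime_rep q).
rewrite mem_iota ltnS le_q mem_words_over eqxx; split=> //.
by apply/allP => s _; rewrite /= mem_enum.
Qed.

(** [expr2_gt] is an Archimedean property: it makes the error $4/2^N$ fall below any given bound. *)
Lemma Lfun_det (expr2_gt : forall x : C, 0 <= x -> exists N, x < 2 ^+ N) :
  exists2 r : C, 0 < r & forall u, `|u| <= r ->
  Lfun_converges F rho u /\ (Lfun F rho u)^-1 = \det (1%:M - u *: W_rho F rho).
Proof.
have [r r_gt0 hr] := euler_product_close; exists r => // u ur.
have [nz0 D0 close] := hr u ur.
have FF := @totally_filter (prime_path X).
suff cvL : (partial_euler_product F rho u @ totally -->
    (\det (1%:M - u *: W_rho F rho))^-1)%classic.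
  split; first by split=> //; apply/cvg_ex; eexists; exact: cvL.
  by rewrite /Lfun (cvg_lim (@norm_hausdorff _ _) cvL) invrK.
pose P (S : {fset prime_path X}) := \prod_(q <- S) euler_factor F rho u q.
have -> : partial_euler_product F rho u = fun S => (P S)^-1.
  by apply/funext => S; rewrite /partial_euler_product prodfV.
(* The inverse products converge because the limit determinant is nonzero ([D0]). *)
apply: (cvgV (f := P)) => //; apply/cvgrPdist_lt => e e_gt0.
have [N ltN] : exists N, 4 / e < 2 ^+ N.
  by apply: expr2_gt; rewrite divr_ge0 ?ler0n ?ltW.
have {}ltN : 4 / 2 ^+ N < e.
  by rewrite ltr_pdivrMr ?exprn_gt0 ?ltr0n // mulrC -ltr_pdivrMr.
have [A0 memA0] := primes_fset N; exists A0 => // A /= /fsubsetP sA.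
rewrite distrC; apply: le_lt_trans ltN; apply: close; first exact: fset_uniq.
by move=> q le_q; apply: sA; exact: memA0.
Qed.

End EulerProduct.

Theorem proposition4p16 (R : realType) (gT : finGroupType)
    (Y : graph) (Yconn : graph_connected Y)
    (a : graph_action gT Y) (afree : edge_free a)
    (c : quotient_choice a)
    (d : nat) (rho : mx_representation R[i] [set: gT] d) :
  exists2 e : R, 0 < e &
    forall u : R[i], `|u| < e%:C%C ->
      Lfun_converges (X := quotient_gog c) (frob c) rho u /\
      (Lfun (X := quotient_gog c) (frob c) rho u)^-1
        = \det (1%:M - u *: W_rho (X := quotient_gog c) (frob c) rho).
Proof.
(* Nonnegative elements of [R[i]] are real, which transfers the Archimedean property from [R] and
   lets the radius be taken in [R]. *)
have real_ge0 (x : R[i]) : 0 <= x -> x = (complex.Re x)%:C%C.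
  by case: x => x y; rewrite lecE /= => /andP[/eqP-> _].
have expr2_gt (x : R[i]) : 0 <= x -> exists N, x < 2 ^+ N.
  move=> x_ge0; exists (Num.bound (complex.Re x)).
  have -> : 2 = (2 : R)%:C%C by rewrite rmorph_nat.
  rewrite (real_ge0 x x_ge0) -rmorphXn ltcR.
  exact: upper_nthrootP.
have [r r_gt0 hr] := Lfun_det (X := quotient_gog c) (frob c) rho expr2_gt.
have er := real_ge0 r (ltW r_gt0).
exists (complex.Re r); first by rewrite -ltcR -er.
by move=> u ur; apply: hr; rewrite er ltW.
Qed.
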